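(* Let $k\geq 1$ and $n\geq 3$ be integers. If $n\leq 2k+1$, then $\operatorname{sdepth}(S/I(C_n^k))=1$. If $n\geq 2k+2$, then: (i) if $n\equiv 0,k+1,k+2,\dots,2k \pmod{2k+1}$, then $\operatorname{sdepth}(S/I(C_n^k))=\left\lceil\frac{n}{2k+1}\right\rceil$; (ii) if $n\equiv 1,2,\dots,k\pmod{2k+1}$, then $\left\lceil\frac{n}{2k+1}\right\rceil-1\leq\operatorname{sdepth}(S/I(C_n^k))\leq\left\lceil\frac{n}{2k+1}\right\rceil$.
   Context: $K$ is a field and $S=K[x_1,\dots,x_n]$ is the polynomial ring. $C_n^k$ denotes the $k$-th power of the cycle on the vertex set $\{1,\dots,n\}$ ($n\ge 3$): for $1\le i<j\le n$, $\{i,j\}$ is an edge if and only if $j-i\le k$ or $j-i\ge n-k$ (so $C_n^k$ is the complete graph when $n\le 2k+1$). Its edge ideal $I(C_n^k)\subset S$ is the squarefree monomial ideal generated by all $x_ix_j$ with $\{i,j\}$ an edge of $C_n^k$. Stanley depth: let $M$ be a finitely generated $\mathbb{Z}^n$-graded $S$-module. A Stanley decomposition of $M$ is a presentation of the $K$-vector space $M$ as a finite direct sum $\mathcal{D}: M=\bigoplus_{i=1}^s v_iK[W_i]$, where each $v_i\in M$ is homogeneous, $W_i\subseteq\{x_1,\dots,x_n\}$, $v_iK[W_i]$ is the $K$-subspace generated by all $v_iw$ with $w$ a monomial in $K[W_i]$, and $v_iK[W_i]$ is a free $K[W_i]$-module. Put $\operatorname{sdepth}(\mathcal{D})=\min_i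 |W_i|$, and $\operatorname{sdepth}(M)=\max\{\operatorname{sdepth}(\mathcal{D}):\mathcal{D}\text{ a Stanley decomposition of }M\}$. *)

(* Defs.v *)
From HB Require Import structures.
From mathcomp Require Import all_boot all_order all_algebra.
From mathcomp Require Import boolp.
From mathcomp Require Import mpoly.

Set Implicit Arguments.
Unset Strict Implicit.
Unset Printing Implicit Defensive.

Import Order.TTheory GRing.Theory Num.Theory.

Local Open Scope ring_scope.
Local Open Scope quotient_scope.

Section IdealQuotientModule.
Variables (R : comNzRingType) (I : idealr R).
Local Notation Q := {ideal_quot I}.

Definition ideal_quot_scale (a : R) (x : Q) : Q := \pi_Q a * x.

Fact ideal_quot_scalerA a b x :
  ideal_quot_scale a (ideal_quot_scale b x) = ideal_quot_scale (a * b) x.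
Proof. by rewrite /ideal_quot_scale rmorphM mulrA. Qed.

Fact ideal_quot_scale1r : left_id 1 ideal_quot_scale.
Proof. by move=> x; rewrite /ideal_quot_scale rmorph1 mul1r. Qed.

Fact ideal_quot_scalerDr : right_distributive ideal_quot_scale +%R.
Proof. by move=> a x y; rewrite /ideal_quot_scale mulrDr. Qed.

Fact ideal_quot_scalerDl x : {morph ideal_quot_scale^~ x : a b / a + b}.
Proof. by move=> a b; rewrite /ideal_quot_scale rmorphD mulrDl. Qed.

HB.instance Definition _ := GRing.Zmodule_isLmodule.Build R Q
  ideal_quot_scalerA ideal_quot_scale1r ideal_quot_scalerDr
  ideal_quot_scalerDl.

Lemma ideal_quot_scaleE (a b : R) : a *: (\pi_Q b : Q) = \pi_Q (a * b).
Proof. by rewrite /GRing.scale /= /ideal_quot_scale rmorphM. Qed.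

Lemma ideal_quot_eq0 (a : R) : (\pi_Q a == 0 :> Q) = (a \in I).
Proof. by rewrite -[0 in LHS](rmorph0 (\pi_Q)) -Quotient.idealrBE subr0. Qed.

End IdealQuotientModule.

(* V is the internal direct sum of the (possibly infinite) family of subgroups
   U; f picks one element in each U i, and s is a finite set of indices. *)
Definition direct_sum (V : zmodType) (I : eqType) (U : I -> V -> Prop) : Prop :=
  (forall x : V, exists (s : seq I) (f : I -> V),
     [/\ uniq s, forall i, U i (f i) & x = \sum_(i <- s) f i]) /\
  (forall (s : seq I) (f : I -> V),
     uniq s -> (forall i, U i (f i)) -> \sum_(i <- s) f i = 0 ->
     forall i, i \in s -> f i = 0).

Definition multideg n (m : 'X_{1..n}) : {ffun 'I_n -> int} :=
  [ffun i => (m i)%:Z].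

Record fgGradedModule (K : fieldType) (n : nat) := FgGradedModule {
  grmod_sort :> lmodType {mpoly K[n]};
  grcomp : {ffun 'I_n -> int} -> grmod_sort -> Prop;
  grcomp0 : forall a, grcomp a 0;
  grcompD : forall a x y, grcomp a x -> grcomp a y -> grcomp a (x + y);
  grcompZ : forall a (c : K) x, grcomp a x -> grcomp a (c%:MP *: x);
  grcompX : forall a (m : 'X_{1..n}) x,
    grcomp a x -> grcomp (a + multideg m) ('X_[m] *: x);
  grcomp_direct : direct_sum grcomp;
  grmod_fg : exists g : seq grmod_sort, forall x, exists c : 'I_(size g) ->
    {mpoly K[n]}, x = \sum_i c i *: g`_i
}.

Section StanleyDepth.
Variables (K : fieldType) (n : nat) (M : fgGradedModule K n).

Definition homogeneous_elt (v : M) : Prop := exists a, grcomp a v.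

(* p lies in the polynomial subring K[W]. *)
Definition in_subring (W : {set 'I_n}) (p : {mpoly K[n]}) : Prop :=
  forall m, m \in msupp p -> forall i, m i != 0%N -> i \in W.

Definition stanley_space (v : M) (W : {set 'I_n}) (x : M) : Prop :=
  exists2 p, in_subring W p & x = p *: v.

(* v K[W] is free over K[W] with basis v. *)
Definition stanley_free (v : M) (W : {set 'I_n}) : Prop :=
  forall p, in_subring W p -> p *: v = 0 -> p = 0.

Definition stanley_decomposition (s : nat) (v : 'I_s -> M)
    (W : 'I_s -> {set 'I_n}) : Prop :=
  [/\ forall i, homogeneous_elt (v i),
      forall i, stanley_free (v i) (W i)
    & direct_sum (fun i => stanley_space (v i) (W i))].

(* As #|W i| <= n, the neutral element n only matters when s = 0, which
   happens for the zero module only. *)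
Definition sdepth_decomposition (s : nat) (W : 'I_s -> {set 'I_n}) : nat :=
  \big[minn/n]_(i < s) #|W i|.

(* Every sdepth_decomposition is at most n, so this is the maximum over all
   Stanley decompositions. *)
Definition sdepth : nat :=
  \max_(d < n.+1 | `[< exists (s : nat) (v : 'I_s -> M)
                         (W : 'I_s -> {set 'I_n}),
                       stanley_decomposition v W /\
                       sdepth_decomposition W = d >]) d.

End StanleyDepth.

Section EdgeIdeal.
Variables (K : fieldType) (n : nat) (e : rel 'I_n).
Local Notation S := {mpoly K[n]}.

Definition edge_ideal : {pred S} := fun p =>
  `[< exists q : 'I_n -> 'I_n -> S,
        p = \sum_i \sum_(j | e i j) q i j * ('X_i * 'X_j) >].

Definition edge_mon (m : 'X_{1..n}) : bool :=
  [exists i, exists j, e i j && (U_(i) + U_(j) <= m)%MM].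

Lemma edge_ideal_lin (a u v : S) :
  u \in edge_ideal -> v \in edge_ideal -> a * u + v \in edge_ideal.
Proof.
move=> /asboolP[q ->] /asboolP[r ->]; apply/asboolP.
exists (fun i j => a * q i j + r i j).
rewrite mulr_sumr -big_split; apply: eq_bigr => i _ /=.
rewrite mulr_sumr -big_split; apply: eq_bigr => j _ /=.
by rewrite mulrDl mulrA.
Qed.

Lemma edge_ideal0 : 0 \in edge_ideal.
Proof.
apply/asboolP; exists (fun _ _ => 0).
by rewrite big1 // => i _; rewrite big1 // => j _; rewrite mul0r.
Qed.

Lemma edge_mon_ideal (c : K) m : edge_mon m -> c *: 'X_[m] \in edge_ideal.
Proof.
case/existsP=> i /existsP[j /andP[eij le_m]]; apply/asboolP.
exists (fun i' j' => if (i' == i) && (j' == j)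
                     then c *: 'X_[m - (U_(i) + U_(j))] else 0).
rewrite (bigD1 i) //= (bigD1 j) //= !eqxx /=.
rewrite big1 => [|j' /andP[_ /negPf->]]; last by rewrite mul0r.
rewrite big1 => [|i' /negPf ni]; last first.
  by rewrite big1 // => j' _; rewrite ni mul0r.
by rewrite !addr0 -mpolyXD -scalerAl -mpolyXD submK.
Qed.

Lemma edge_idealP (p : S) :
  reflect (forall m, m \in msupp p -> edge_mon m) (p \in edge_ideal).
Proof.
apply: (iffP idP) => [/asboolP[q ->] m | hp].
  apply: contraTT => nm; rewrite -mcoeff_eq0 raddf_sum big1 //= => i _.
  rewrite raddf_sum big1 //= => j eij; rewrite -mpolyXD.
  apply/eqP; rewrite mcoeff_eq0 (perm_mem (msuppMX _ _)).
  apply: contra nm => /mapP[m' _ ->].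
  by apply/existsP; exists i; apply/existsP; exists j; rewrite eij lem_addr.
rewrite [p]mpolyE big_seq.
apply: (big_ind (fun x => x \in edge_ideal)) => [|x y xI yI|m /hp].
- exact: edge_ideal0.
- by rewrite -[x]mul1r; apply: edge_ideal_lin.
- exact: edge_mon_ideal.
Qed.

Fact edge_ideal_closed : idealr_closed edge_ideal.
Proof.
split; [exact: edge_ideal0 | | by move=> a u v; apply: edge_ideal_lin].
apply/negP=> /edge_idealP/(_ 0%MM).
rewrite msupp1 inE eqxx => /(_ isT)/existsP[i /existsP[j /andP[_]]].
by move/mnm_lepP/(_ i); rewrite mnmDE mnm0E mnm1E eqxx.
Qed.

HB.instance Definition _ := isIdealr.Build S edge_ideal edge_ideal_closed.

End EdgeIdeal.

Arguments edge_ideal K {n} e.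

Section EdgeQuotient.
Variables (K : fieldType) (n : nat) (e : rel 'I_n).
Local Notation S := {mpoly K[n]}.
Local Notation Q := {ideal_quot (edge_ideal K e)}.

Definition multihomog (a : {ffun 'I_n -> int}) (p : S) : Prop :=
  forall m, m \in msupp p -> multideg m = a.

Definition edge_quot_comp (a : {ffun 'I_n -> int}) (x : Q) : Prop :=
  exists2 p : S, multihomog a p & x = \pi_Q p.

Fact edge_quot_comp0 a : edge_quot_comp a 0.
Proof. by exists 0; [move=> m; rewrite msupp0 | rewrite rmorph0]. Qed.

Fact edge_quot_compD a x y :
  edge_quot_comp a x -> edge_quot_comp a y -> edge_quot_comp a (x + y).
Proof.
move=> [p hp ->] [q hq ->]; exists (p + q); last by rewrite rmorphD.
by move=> m /msuppD_le; rewrite mem_cat => /orP[/hp|/hq].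
Qed.

Fact edge_quot_compZ a (c : K) x :
  edge_quot_comp a x -> edge_quot_comp a (c%:MP *: x).
Proof.
move=> [p hp ->]; exists (c%:MP * p); last by rewrite ideal_quot_scaleE.
by move=> m; rewrite mul_mpolyC => /msuppZ_le/hp.
Qed.

Fact edge_quot_compX a (m : 'X_{1..n}) x :
  edge_quot_comp a x -> edge_quot_comp (a + multideg m) ('X_[m] *: x).
Proof.
move=> [p hp ->]; exists ('X_[m] * p); last by rewrite ideal_quot_scaleE.
move=> m'; rewrite mulrC (perm_mem (msuppMX _ _)) => /mapP[m1 /hp <- ->].
by apply/ffunP=> i; rewrite !ffunE mnmDE PoszD addrC.
Qed.

Fact edge_quot_direct : direct_sum edge_quot_comp.
Proof.
split=> [x|s f us hf sum0 a sa].
  pose p : S := repr x.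
  exists (undup [seq multideg m | m <- msupp p]).
  exists (fun a => \pi_Q (\sum_(m <- msupp p | multideg m == a)
                            p@_m *: 'X_[m])).
  split; first exact: undup_uniq.
    move=> a; eexists; last by [].
    apply: (big_ind (fun q => multihomog a q)) => [m|q r hq hr m|m /eqP<- m'].
    - by rewrite msupp0.
    - by move=> /msuppD_le; rewrite mem_cat => /orP[/hq|/hr].
    - by move=> /msuppZ_le; rewrite msuppX inE => /eqP->.
  rewrite -rmorph_sum /= -[LHS]reprK; congr \pi_Q.
  rewrite -/p {1}[p]mpolyE.
  under [RHS]eq_bigr do rewrite big_mkcond.
  rewrite exchange_big /= !big_seq; apply: eq_bigr => m mp.
  rewrite (bigD1_seq (multideg m)) ?undup_uniq ?mem_undup ?map_f //= eqxx.
  by rewrite big1 ?addr0 // => b /negPf nb; rewrite eq_sym nb.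
pose p b := s2val (cid2 (hf b)).
have hp b : multihomog b (p b) /\ f b = \pi_Q (p b).
  by rewrite /p; case: (cid2 (hf b)).
have : \pi_Q (\sum_(b <- s) p b) = 0 :> Q.
  rewrite rmorph_sum -[RHS]sum0; apply: eq_bigr => b _.
  by rewrite (hp b).2.
move/eqP; rewrite ideal_quot_eq0 => /edge_idealP sumI.
apply/eqP; rewrite (hp a).2 ideal_quot_eq0; apply/edge_idealP => m ma.
apply: sumI; rewrite mcoeff_msupp raddf_sum (bigD1_seq a) //=.
rewrite big1 ?addr0 -?mcoeff_msupp // => b nba.
apply/eqP; rewrite mcoeff_eq0; apply: contra nba => /(hp b).1 <-.
by rewrite ((hp a).1 _ ma).
Qed.

Fact edge_quot_fg : exists g : seq Q, forall x, exists c : 'I_(size g) -> S,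
  x = \sum_i c i *: g`_i.
Proof.
exists [:: 1] => x; exists (fun=> repr x).
by rewrite big_ord1 /= /GRing.scale /= /ideal_quot_scale mulr1 reprK.
Qed.

Definition edge_quot : fgGradedModule K n :=
  FgGradedModule edge_quot_comp0 edge_quot_compD edge_quot_compZ
    edge_quot_compX edge_quot_direct edge_quot_fg.

End EdgeQuotient.

Arguments edge_quot K {n} e.

(* The vertices 1, ..., n are shifted to 0, ..., n - 1. The truncation of n - k
   is harmless: for n <= k all pairs are adjacent in either reading. *)
Definition cycle_power (n k : nat) : rel 'I_n := fun i j =>
  let adj (a b : nat) := (a < b)%N && ((b - a <= k) || (n - k <= b - a))%N in
  adj i j || adj j i.

Arguments cycle_power : clear implicits.

(* Main.v *)
(* In a Stanley decomposition of S/I the summand containing the product of the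
   variables in a facet F only uses variables of F, so the depth is at most #|F|;
   an independent dominating set with at most ceil(n / (2k + 1)) vertices gives
   the upper bound.  Conversely, a partition of the independence complex into
   intervals [A, B] yields the Stanley decomposition with summands x_A K[B].
   Such partitions are built by splitting off one vertex at a time (deletion and
   link) and by taking cones: this gives #|B| >= ceil(l / (2k + 1)) for the power
   of a path on l vertices, and #|B| >= ceil((n - k) / (2k + 1)) for the cycle
   after removing k consecutive vertices. *)
Require Import Defs.
From HB Require Import structures.
From mathcomp Require Import all_boot all_order all_algebra.
From mathcomp Require Import boolp.
From mathcomp Require Import mpoly.
From mathcomp Require Import zify.

Set Implicit Arguments.
Unset Strict Implicit.
Unset Printing Implicit Defensive.

Import Order.TTheory GRing.Theory Num.Theory.

Local Open Scope ring_scope.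

(** * Interval partitions of independence complexes *)

Section IndependentSets.
Variables (T : finType) (e : rel T).
Implicit Types (A F G U : {set T}) (u v : T) (d : nat).

Definition indep A : bool := [forall i in A, forall j in A, ~~ e i j].

Lemma indepP A : reflect {in A &, forall i j, ~~ e i j} (indep A).
Proof.
apply: (iffP forall_inP) => [h i j iA jA|h i iA].
  exact: (forall_inP (h i iA)).
by apply/forall_inP => j jA; apply: h.
Qed.

Lemma indep_sub A F : A \subset F -> indep F -> indep A.
Proof. by move=> /subsetP sAF /indepP h; apply/indepP => i j /sAF iF /sAF; apply: h. Qed.

Lemma indep_setU1 v A : ~~ e v v -> indep A ->
  {in A, forall u, ~~ e v u /\ ~~ e u v} -> indep (v |: A).
Proof.
move=> nvv /indepP iA h; apply/indepP => i j.
rewrite !in_setU1 => /orP[/eqP->|Ai] /orP[/eqP->|Aj] //.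
- by case: (h j Aj).
- by case: (h i Ai).
exact: iA.
Qed.

(* The intervals are the sets of the form [lo F, hi F]; the last clause says
   that they are pairwise equal or disjoint. *)
Definition interval_partition U d : Prop :=
  exists lo hi : {set T} -> {set T}, forall F, F \subset U -> indep F ->
  [/\ lo F \subset F /\ F \subset hi F, hi F \subset U, indep (hi F),
      (d <= #|hi F|)%N
    & forall G, lo F \subset G -> G \subset hi F ->
        lo G = lo F /\ hi G = hi F].

Lemma interval_partition0 U : interval_partition U 0.
Proof.
exists id, id => F sFU iF; split => // G sFG sGF.
by have -> : G = F by apply/eqP; rewrite eqEsubset sFG sGF.
Qed.

(** Faces avoiding [v] are the faces of the deletion; faces containing [v] are those of the link
    with [v] added. Adding [v] to both ends of each link interval raises its upper size by one, so
    the link only has to reach [d.-1]. *)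
Lemma interval_partition_link U v d :
    interval_partition (U :\ v) d ->
    interval_partition [set u in U | [&& u != v, ~~ e v u & ~~ e u v]] d.-1 ->
  interval_partition U d.
Proof.
move=> [lo1 [hi1 h1]] [lo2 [hi2 h2]].
exists (fun F => if v \in F then v |: lo2 (F :\ v) else lo1 F).
exists (fun F => if v \in F then v |: hi2 (F :\ v) else hi1 F).
move=> F sFU iF; case: ifPn => vF; last first.
  have sFU' : F \subset U :\ v by rewrite subsetD1 sFU.
  have [sub shU ih dh hG] := h1 F sFU' iF.
  split => //; first by apply: subset_trans shU (subsetDl _ _).
  move=> G sG Gs; suff /negPf-> : v \notin G by exact: hG.
  by apply/negP => vG; have := subsetP shU v (subsetP Gs v vG); rewrite setD11.
have nvv : ~~ e v v by move/indepP: iF => /(_ v v vF vF).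
have sF' : F :\ v \subset
    [set u in U | [&& u != v, ~~ e v u & ~~ e u v]].
  apply/subsetP => u /setD1P[nuv uF]; rewrite inE nuv (subsetP sFU) //=.
  by move/indepP: iF => h; rewrite !h.
have [[sl sh] shU ih dh hG] := h2 _ sF' (indep_sub (subsetDl F [set v]) iF).
have vh : v \notin hi2 (F :\ v).
  by apply/negP => /(subsetP shU); rewrite inE eqxx andbF.
split.
- split; first by rewrite subUset sub1set vF (subset_trans sl) ?subsetDl.
  by rewrite -{1}(setD1K vF) setUS.
- rewrite subUset sub1set (subsetP sFU) //=.
  by apply: subset_trans shU _; apply/subsetP => u; rewrite inE => /andP[].
- apply: indep_setU1 => // u /(subsetP shU).
  by rewrite inE => /and4P[_ _ -> ->].
- by rewrite cardsU1 vh; case: d dh {h1 h2}.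
move=> G sG Gs.
have vG : v \in G by apply: (subsetP sG); rewrite setU11.
rewrite vG; have [] := hG (G :\ v); last by move=> -> ->.
  apply/subsetP => u ul; rewrite !inE (subsetP sG) ?inE ?ul ?orbT ?andbT //.
  by have := subsetP sl u ul; rewrite !inE => /andP[].
apply/subsetP => u /setD1P[nuv uG].
by have := subsetP Gs u uG; rewrite !inE (negPf nuv).
Qed.

(** Since [v] is joined to nothing, adding it to the upper ends only keeps them independent, and
    each new interval covers a face both with and without [v]. *)
Lemma interval_partition_cone U v d :
    v \in U -> {in U, forall u, ~~ e v u /\ ~~ e u v} ->
  interval_partition (U :\ v) d.-1 -> interval_partition U d.
Proof.
move=> vU isov [lo1 [hi1 h1]].
exists (fun F => lo1 (F :\ v)), (fun F => v |: hi1 (F :\ v)) => F sFU iF.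
have [[sl sh] shU ih dh hG] :=
  h1 _ (setSD [set v] sFU) (indep_sub (subsetDl F [set v]) iF).
have vh : v \notin hi1 (F :\ v).
  by apply/negP => /(subsetP shU); rewrite setD11.
have shU' : hi1 (F :\ v) \subset U by apply: subset_trans shU (subsetDl _ _).
split.
- split; first exact: subset_trans sl (subsetDl _ _).
  apply/subsetP => u uF; rewrite in_setU1; case: eqVneq => //= nuv.
  by apply: (subsetP sh); rewrite in_setD1 nuv.
- by rewrite subUset sub1set vU.
- apply: indep_setU1 => //; first by case: (isov v vU).
  by move=> u /(subsetP shU'); apply: isov.
- by rewrite cardsU1 vh; case: d dh {h1}.
move=> G sG Gs; have [] := hG (G :\ v); last by move=> -> ->.
  apply/subsetP => u ul; rewrite in_setD1 (subsetP sG) // andbT.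
  by have := subsetP sl u ul; rewrite !inE => /andP[].
apply/subsetP => u /setD1P[nuv uG].
by have := subsetP Gs u uG; rewrite !inE (negPf nuv).
Qed.

(** Delete vertices until one is left; that one is a cone over the empty set. The links only have to
    reach 0. *)
Lemma interval_partition1 U :
  irreflexive e -> U != set0 -> interval_partition U 1.
Proof.
move=> irr; have [m] := ubnP #|U|; elim: m U => // m IHm U ltm.
case/set0Pn => v vU; have [U0|nU0] := eqVneq (U :\ v) set0; last first.
  apply: (@interval_partition_link _ v); last exact: interval_partition0.
  by apply: IHm => //; move: ltm; rewrite (cardsD1 v) vU.
apply: (@interval_partition_cone _ v) => //; last exact: interval_partition0.
move=> u uU; have : u \notin U :\ v by rewrite U0 inE.
by rewrite in_setD1 uU andbT negbK => /eqP->; rewrite irr.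
Qed.

End IndependentSets.

(** * Stanley decompositions: the facet bound and the interval bound *)

Section StanleyDecompositions.
Variables (K : fieldType) (n : nat) (e : rel 'I_n).
Hypothesis irr : irreflexive e.
Local Notation S := {mpoly K[n]}.
Local Notation Q := {ideal_quot (edge_ideal K e)}.
Implicit Types (m : 'X_{1..n}) (A F W : {set 'I_n}).

Definition mon_of_set A : 'X_{1..n} := [multinom (i \in A : nat) | i < n].

Definition mon_support m : {set 'I_n} := [set i | m i != 0%N].

Lemma mon_support_set A : mon_support (mon_of_set A) = A.
Proof. by apply/setP => i; rewrite inE mnmE; case: (i \in A). Qed.

Lemma mon_of_set_le A m : (mon_of_set A <= m)%MM = (A \subset mon_support m).
Proof.
apply/mnm_lepP/subsetP => h i.
  by move=> iA; have := h i; rewrite inE mnmE iA lt0n.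
by rewrite mnmE; case: (boolP (i \in A)) => // /h; rewrite inE lt0n.
Qed.

(** Without loops the generators are squarefree, so membership of a monomial in the ideal depends on
    its support only. *)
Lemma edge_mon_indep m : edge_mon e m = ~~ indep e (mon_support m).
Proof.
apply/idP/idP.
  case/existsP => i /existsP[j /andP[eij /mnm_lepP le]].
  apply/negP => /indepP/(_ i j); rewrite !inE eij => h.
  have hi := le i; have hj := le j; move: hi hj.
  rewrite !mnmDE !mnm1E !eqxx => hi hj.
  have i0 : m i != 0%N by lia.
  have j0 : m j != 0%N by lia.
  by have := h i0 j0.
move=> nind; apply: contraNT nind => ne; apply/indepP => i j.
rewrite !inE => i0 j0; apply: contra ne => eij.
apply/existsP; exists i; apply/existsP; exists j; rewrite eij /=.
apply/mnm_lepP => l; rewrite mnmDE !mnm1E.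
have [il|_] := eqVneq i l; have [jl|_] := eqVneq j l; rewrite ?add0n ?addn0 //.
- by move: eij; rewrite il jl irr.
- by rewrite -il lt0n.
- by rewrite -jl lt0n.
Qed.

Lemma quot_eq0P (p : S) : reflect (forall m, m \in msupp p -> edge_mon e m)
  ((\pi_Q p)%qT == 0 :> Q).
Proof. by rewrite ideal_quot_eq0; apply: edge_idealP. Qed.

Lemma big_minn_le (I : eqType) (r : seq I) (x : nat) (f : I -> nat) i :
  i \in r -> (\big[minn/x]_(j <- r) f j <= f i)%N.
Proof.
elim: r => // j r IHr; rewrite inE big_cons geq_min => /orP[/eqP<-|/IHr ->].
  by rewrite leqnn.
by rewrite orbT.
Qed.

(* A facet [F] of the independence complex: the summand through the monomial
   x_F only uses variables whose product with x_F stays nonzero, i.e. variables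
   indexed by [F]. *)
Lemma sdepth_le_facet F : indep e F ->
  (forall w, w \notin F -> ~~ indep e (w |: F)) ->
  (sdepth (edge_quot K e) <= #|F|)%N.
Proof.
move=> iF maxF; apply/bigmax_leqP => d /asboolP[s [v [W [[hom free [ex _]] <-]]]].
suff [i le] : exists i, (#|W i| <= #|F|)%N.
  by apply: leq_trans le; apply: big_minn_le; rewrite mem_index_enum.
have [r [f [_ hf xE]]] := ex (\pi_Q 'X_[mon_of_set F])%qT.
have /choice[p hp] : forall i, exists p, in_subring (W i) p /\ f i = p *: v i.
  by move=> i; case: (hf i) => p ? ?; exists p.
have /choice[q hq] : forall i, exists q : S,
    (exists a, multihomog a q) /\ v i = (\pi_Q q)%qT :> Q.
  by move=> i; case: (hom i) => a [q ? ?]; exists q; split=> //; exists a.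
have fE i : f i = (\pi_Q (p i * q i))%qT :> Q.
  by rewrite (hp i).2 (hq i).2; apply: (ideal_quot_scaleE (edge_ideal K e)).
have /quot_eq0P sub0 :
    (\pi_Q ('X_[mon_of_set F] - \sum_(i <- r) p i * q i))%qT == 0 :> Q.
  rewrite rmorphB rmorph_sum /= subr_eq0; apply/eqP.
  by rewrite [LHS]xE; apply: eq_bigr => i _; rewrite fE.
(* Otherwise x_F would survive in a difference that lies in the ideal, although [F] is
   independent. *)
have [i mi] : exists i, mon_of_set F \in msupp (p i * q i).
  apply/not_existsP => nex.
  have /sub0 : mon_of_set F \in msupp ('X_[mon_of_set F] - \sum_(i <- r) p i * q i).
    rewrite mcoeff_msupp mcoeffB mcoeffX eqxx raddf_sum big1 /= ?subr0 ?oner_eq0 //.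
    by move=> i _; apply: memN_msupp_eq0; apply/negP/nex.
  by rewrite edge_mon_indep mon_support_set iF.
exists i; apply: subset_leq_card; apply/subsetP => w wW.
case/msuppM_le/allpairsP: mi => -[m1 m2] /= [m1p m2q FE].
apply: contraT => /maxF niwF.
(* A polynomial of a single multidegree is a scalar multiple of one monomial. *)
have hom_q : q i = (q i)@_m2 *: 'X_[m2].
  have [a ha] := (hq i).1; apply/mpolyP => m; rewrite mcoeffZ mcoeffX.
  have [<-|nm] := eqVneq m2 m; first by rewrite mulr1.
  rewrite mulr0; apply/memN_msupp_eq0/negP => mq; case/eqP: nm.
  apply/mnmP => j; have := ha _ mq; rewrite -(ha _ m2q) => /ffunP/(_ j).
  by rewrite !ffunE => -[].
(* As m1 m2 = x_F and x_w x_F lies in the ideal, x_w m1 annihilates [v i], against freeness over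
   K[W i]. *)
suff : 'X_[U_(w) + m1] = 0 :> S by move/eqP; rewrite -msupp_eq0 msuppX.
apply: (free i).
  move=> m; rewrite msuppX inE => /eqP-> j; rewrite mnmDE mnm1E.
  have [<- //|_] := eqVneq w j; rewrite add0n.
  exact: (hp i).1 m1p j.
rewrite (hq i).2; apply/eqP.
rewrite [X in X == _](ideal_quot_scaleE (edge_ideal K e)) hom_q.
apply/quot_eq0P => m; rewrite -scalerAr -mpolyXD => /msuppZ_le.
rewrite msuppX inE => /eqP->; rewrite edge_mon_indep -addmA -FE.
apply: contra niwF; apply: indep_sub; apply/subsetP => j.
rewrite !inE mnmDE mnm1E mnmE [w == j]eq_sym.
by case: (eqVneq j w) => //= _; case: (j \in F).
Qed.

(** The monomials with independent support form a basis of the quotient, and such a monomial lies in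
    x_A K[W] exactly when its support lies in [A, W]. So a partition into intervals partitions this
    basis. *)
Lemma stanley_decomposition_intervals (s : nat) (A W : 'I_s -> {set 'I_n})
    (idx : {set 'I_n} -> 'I_s) :
  (forall i, A i \subset W i) -> (forall i, indep e (W i)) ->
  (forall F, indep e F -> A (idx F) \subset F /\ F \subset W (idx F)) ->
  (forall i F, A i \subset F -> F \subset W i -> idx F = i) ->
  stanley_decomposition (M := edge_quot K e)
    (fun i => (\pi_Q 'X_[mon_of_set (A i)])%qT : Q) W.
Proof.
move=> sAW iW hidx idxE.
have supp_space i (p : S) m : in_subring (W i) p ->
    m \in msupp (p * 'X_[mon_of_set (A i)]) ->
    A i \subset mon_support m /\ mon_support m \subset W i.
  move=> hp; rewrite (perm_mem (msuppMX _ _)) => /mapP[m' m'p ->].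
  split; first by rewrite -mon_of_set_le lem_addr.
  apply/subsetP => j; rewrite inE mnmDE mnmE.
  case: (boolP (j \in A i)) => [/(subsetP (sAW i))//|_].
  by rewrite add0n; apply: hp.
have nonedge i (p : S) m : in_subring (W i) p ->
    m \in msupp (p * 'X_[mon_of_set (A i)]) -> ~~ edge_mon e m.
  move=> hp /(supp_space i _ _ hp)[_ sW].
  by rewrite edge_mon_indep negbK (indep_sub sW).
split.
- move=> i; exists (multideg (mon_of_set (A i))), 'X_[mon_of_set (A i)] => //.
  by move=> m; rewrite msuppX inE => /eqP->.
- move=> i p hp /eqP.
  rewrite [X in X == _](ideal_quot_scaleE (edge_ideal K e)) => /quot_eq0P h.
  apply/eqP; rewrite -msupp_eq0; case E: (msupp p) => [//|m t].
  have mp : (mon_of_set (A i) + m)%MM \in msupp (p * 'X_[mon_of_set (A i)]).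
    by rewrite (perm_mem (msuppMX _ _)) map_f // E mem_head.
  by have := h _ mp; rewrite (negPf (nonedge _ _ _ hp mp)).
split=> [x|r f ur hf sum0 i ir].
  pose p : S := repr (x : Q).
  (* The terms of [p] outside the ideal whose support lies in interval [i], each divided by x_A. *)
  pose g i : S := \sum_(m <- msupp p | ~~ edge_mon e m && (idx (mon_support m) == i))
                    p@_m *: 'X_[m - mon_of_set (A i)].
  exists (enum 'I_s), (fun i => (\pi_Q (g i * 'X_[mon_of_set (A i)]))%qT).
  split; first exact: enum_uniq.
    move=> i; exists (g i); last first.
      by rewrite [RHS](ideal_quot_scaleE (edge_ideal K e)).
    rewrite /g; apply: (big_ind (fun q => in_subring (W i) q)).
    - by move=> m; rewrite msupp0.
    - by move=> q q' hq hq' m /msuppD_le; rewrite mem_cat => /orP[/hq|/hq'].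
    move=> m /andP[nm /eqP im] m' /msuppZ_le; rewrite msuppX inE => /eqP-> j.
    have [] := hidx (mon_support m); first by move: nm; rewrite edge_mon_indep negbK.
    rewrite im => _ /subsetP sW; rewrite mnmBE => mj; apply: sW; rewrite inE.
    by apply: contra mj => /eqP->.
  rewrite -rmorph_sum /= -[LHS](reprK (x : Q)) -/p.
  apply/eqP; rewrite -subr_eq0 -rmorphB /=; apply/quot_eq0P => m.
  (* Compare coefficients at a monomial outside the ideal: only the summand indexed by the interval
     of its support contributes. *)
  apply: contraTT => nm; rewrite -mcoeff_eq0 mcoeffB raddf_sum /= subr_eq0.
  rewrite (bigD1_seq (idx (mon_support m))) ?enum_uniq ?mem_enum //=.
  have hm : indep e (mon_support m) by move: nm; rewrite edge_mon_indep negbK.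
  have [sA sW] := hidx _ hm.
  have gE i : g i * 'X_[mon_of_set (A i)] =
      \sum_(m <- msupp p | ~~ edge_mon e m && (idx (mon_support m) == i)) p@_m *: 'X_[m].
    rewrite /g mulr_suml; apply: eq_bigr => m' /andP[nm' /eqP im'].
    rewrite -scalerAl -mpolyXD submK // mon_of_set_le.
    have [] := hidx (mon_support m'); last by rewrite im'.
    by move: nm'; rewrite edge_mon_indep negbK.
  have gC i : (g i * 'X_[mon_of_set (A i)])@_m =
      if idx (mon_support m) == i then p@_m else 0.
    rewrite gE raddf_sum /=.
    have [mp|mp] := boolP (m \in msupp p); last first.
      rewrite (memN_msupp_eq0 mp) if_same big_seq_cond big1 // => m'.
      case/andP=> m'p _; rewrite mcoeffZ mcoeffX.
      by case: eqVneq => [E|]; [rewrite -E m'p in mp|rewrite mulr0].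
    rewrite big_mkcond (bigD1_seq m) //= big1 => [|m' /negPf nm'].
      by rewrite nm /= addr0 mcoeffZ mcoeffX eqxx mulr1.
    by case: ifP; rewrite // mcoeffZ mcoeffX nm' mulr0.
  rewrite gC eqxx big1 ?addr0 // => i /negPf ni.
  by rewrite gC eq_sym ni.
have /choice[p hp] : forall i, exists p : S, in_subring (W i) p /\
    f i = (\pi_Q (p * 'X_[mon_of_set (A i)]))%qT :> Q.
  move=> j; case: (hf j) => p ? fj; exists p; split=> //.
  by rewrite fj; apply: (ideal_quot_scaleE (edge_ideal K e)).
have /quot_eq0P sumI :
    (\pi_Q (\sum_(j <- r) p j * 'X_[mon_of_set (A j)]))%qT == 0 :> Q.
  rewrite rmorph_sum /=; apply/eqP; rewrite -[RHS]sum0.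
  by apply: eq_bigr => j _; rewrite (hp j).2.
rewrite (hp i).2; apply/eqP/quot_eq0P => m mi; apply: sumI.
(* A monomial of summand [i] occurs in no other summand, so it cannot cancel in the sum. *)
rewrite mcoeff_msupp raddf_sum (bigD1_seq i) //= big1 ?addr0 -?mcoeff_msupp //.
move=> j nji; apply: memN_msupp_eq0; apply: contra nji => mj.
have [sA sW] := supp_space _ _ _ (hp i).1 mi.
have [sA' sW'] := supp_space _ _ _ (hp j).1 mj.
by rewrite -(idxE _ _ sA sW) -(idxE _ _ sA' sW').
Qed.

Lemma interval_partition_sdepth d :
  interval_partition e setT d -> (d <= sdepth (edge_quot K e))%N.
Proof.
case=> lo [hi h].
have {}h F : indep e F -> _ := h F (subsetT F).
have i0 : indep e set0 by apply/indepP => i; rewrite inE.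
(* Many faces share an interval; taking the set of pairs lists each interval once. *)
pose P := [set (lo F, hi F) | F in [set F | indep e F]].
have P0 : (lo set0, hi set0) \in P by apply: imset_f; rewrite inE.
pose A (i : 'I_#|P|) := (enum_val i).1.
pose W (i : 'I_#|P|) := (enum_val i).2.
pose idx F := enum_rank_in P0 (lo F, hi F).
have idxK F : indep e F -> enum_val (idx F) = (lo F, hi F).
  by move=> iF; rewrite enum_rankK_in // imset_f // inE.
have AWE i : exists2 F, indep e F & A i = lo F /\ W i = hi F.
  have /imsetP[F] := enum_valP i; rewrite inE => iF E.
  by exists F; rewrite // /A /W E.
have dec : stanley_decomposition (M := edge_quot K e)
    (fun i => (\pi_Q 'X_[mon_of_set (A i)])%qT : Q) W.
  apply: (stanley_decomposition_intervals (idx := idx)).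
  - move=> i; have [F iF [-> ->]] := AWE i; have [[sl sh] _ _ _ _] := h F iF.
    exact: subset_trans sl sh.
  - by move=> i; have [F iF [_ ->]] := AWE i; have [] := h F iF.
  - by move=> F iF; rewrite /A /W idxK //; have [] := h F iF.
  move=> i F; rewrite /A /W.
  have /imsetP[G] := enum_valP i; rewrite inE => iG E.
  rewrite E /= => sl sh; apply: enum_val_inj.
  have [_ _ ih _ /(_ F sl sh)[lE hE]] := h G iG.
  by rewrite idxK ?(indep_sub sh) // E lE hE.
(* Needed because [n] is the neutral element of the minimum in [sdepth_decomposition]. *)
have dn : (d <= n)%N.
  have [_ _ _ dh _] := h _ i0; apply: leq_trans dh _.
  by rewrite -[X in (_ <= X)%N]card_ord max_card.
have dW i : (d <= #|W i|)%N by have [F iF [_ ->]] := AWE i; have [] := h F iF.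
have le_n : (sdepth_decomposition W < n.+1)%N.
  by rewrite ltnS /sdepth_decomposition; elim/big_ind: _ => // [x y|i _];
    [rewrite geq_min => -> | rewrite -[X in (_ <= X)%N]card_ord max_card].
apply: (@leq_trans (sdepth_decomposition W)).
  rewrite /sdepth_decomposition; elim/big_ind: _ => // x y.
  by rewrite leq_min => -> ->.
apply: (leq_bigmax_cond (Ordinal le_n)); apply/asboolP.
by exists #|P|, (fun i => (\pi_Q 'X_[mon_of_set (A i)])%qT : Q), W.
Qed.

End StanleyDecompositions.

(** * Interval partitions and a small facet for cycle powers *)

Section CyclePowers.
Variables (k n : nat).
Local Notation C := (cycle_power n k).

Lemma cycle_power_irr : irreflexive C.
Proof. by move=> i; rewrite /cycle_power ltnn. Qed.

(* An interval of at most n - k consecutive vertices spans a power of a path.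
   Its first k + 1 vertices are removed in the order a + k, ..., a + 1; what
   remains is a cone over a. *)
Lemma interval_partition_path d a b : (b <= n)%N -> (b - a <= n - k)%N ->
  (d * (2 * k + 1) < b - a + (2 * k + 1))%N ->
  interval_partition C [set i : 'I_n | a <= i < b]%N d.
Proof.
elim: d a b => [|d IHd] a b bn ba dab; first exact: interval_partition0.
(* [U k] is the whole interval; in [U 0] nothing within distance [k] of [a] is left except [a], and
   [b - a <= n - k] excludes wrap-around edges. *)
pose U j := [set i : 'I_n | (a <= i < b) && ~~ (a + j < i <= a + k)]%N.
have ltab : (a < b)%N by lia.
suff h j : (j <= k)%N -> interval_partition C (U j) d.+1.
  rewrite (_ : [set i : 'I_n | _] = U k); first exact: h.
  by apply/setP => i; rewrite !inE; lia.
elim: j => [|j IHj] jk.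
  pose v := Ordinal (leq_trans ltab bn).
  apply: (@interval_partition_cone _ _ _ v) => /=.
  - by rewrite !inE /=; lia.
  - by move=> u; rewrite !inE /cycle_power /=; lia.
  rewrite (_ : _ :\ _ = [set i : 'I_n | a + k + 1 <= i < b]%N).
    by apply: IHd; lia.
  by apply/setP => i; rewrite !inE -val_eqE /=; lia.
have [ltjb|leb] := ltnP (a + j.+1) b; last first.
  rewrite (_ : U j.+1 = U j); first by apply: IHj; lia.
  by apply/setP => i; rewrite !inE; lia.
pose v := Ordinal (leq_trans ltjb bn).
apply: (@interval_partition_link _ _ _ v) => /=.
  rewrite (_ : _ :\ _ = U j); first by apply: IHj; lia.
  by apply/setP => i; rewrite !inE -val_eqE /=; lia.
(* As [j.+1 <= k], the link loses at most 2k + 1 of the positions from [a] on, which costs one unit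
   of depth. *)
rewrite (_ : [set u in _ | _] = [set i : 'I_n | a + j.+1 + k + 1 <= i < b]%N).
  by apply: IHd; lia.
by apply/setP => i; rewrite !inE /cycle_power -val_eqE /=; lia.
Qed.

(** The condition on [d] means d <= ceil((n - k) / (2k + 1)). Vertices 0, ..., k - 1 are split off
    in turn, leaving the path power on k, ..., n - 1. *)
Lemma interval_partition_cycle d : (2 * k + 2 <= n)%N ->
  (d * (2 * k + 1) < n - k + (2 * k + 1))%N ->
  interval_partition C setT d.
Proof.
move=> n_ge dn.
suff h j : (j <= k)%N -> interval_partition C [set i : 'I_n | k - j <= i < n]%N d.
  rewrite (_ : setT = [set i : 'I_n | k - k <= i < n]%N); first exact: h.
  by apply/setP => i; rewrite !inE subnn ltn_ord.
elim: j => [|j IHj] jk; first by apply: interval_partition_path; lia.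
have ltvn : (k - j.+1 < n)%N by lia.
apply: (@interval_partition_link _ _ _ (Ordinal ltvn)).
  rewrite (_ : _ :\ _ = [set i : 'I_n | k - j <= i < n]%N).
    by apply: IHj; lia.
  by apply/setP => i; rewrite !inE -val_eqE /=; lia.
(* Edges on both sides of the split vertex leave n - 2k - 1 consecutive vertices, enough for
   [d.-1]. *)
rewrite (_ : [set u in _ | _] =
    [set i : 'I_n | k - j.+1 + k + 1 <= i < n - j.+1]%N).
  by apply: interval_partition_path; lia.
by apply/setP => i; rewrite !inE /cycle_power -val_eqE /=; lia.
Qed.

(* The multiples of 2k + 1, capped at n - k - 1 so that the last one stays at
   distance more than k from 0. *)
Definition spaced_vertex (j : nat) : nat := minn (j * (2 * k + 1)) (n - k - 1).

Definition spaced_set c : {set 'I_n} :=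
  [set i : 'I_n | [exists j : 'I_c, i == spaced_vertex j :> nat]].

Lemma card_spaced_set c : (#|spaced_set c| <= c)%N.
Proof.
have [n0|n0] := posnP n.
  by apply: leq_trans (max_card _) _; rewrite card_ord n0.
have lt_n j : (spaced_vertex j < n)%N by rewrite /spaced_vertex; lia.
rewrite -[X in (_ <= X)%N]card_ord.
apply: leq_trans (leq_imset_card (fun j : 'I_c => Ordinal (lt_n j)) predT).
apply: subset_leq_card; apply/subsetP => i; rewrite inE => /existsP[j /eqP ij].
by apply/imsetP; exists j => //; apply: val_inj.
Qed.

(** Since (c - 1)(2k + 1) < n, only the last multiple can be capped, and it moves by at most k; its
    gap to the previous one is still at least k + 1. *)
Lemma indep_spaced_set c : (c * (2 * k + 1) < n + (2 * k + 1))%N ->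
  indep C (spaced_set c).
Proof.
move=> cn; apply/indepP => x y.
rewrite !inE => /existsP[i /eqP xi] /existsP[j /eqP yj].
wlog lij : i j x y xi yj / (i <= j)%N => [wl|].
  case/orP: (leq_total i j) => [|lji]; first exact: (wl i j).
  by have := wl j i y x yj xi lji; rewrite /cycle_power orbC.
have [eij|nij] := eqVneq i j.
  by rewrite (_ : x = y) ?cycle_power_irr //; apply: val_inj; rewrite /= xi yj eij.
have step : (i * (2 * k + 1) + (2 * k + 1) <= j * (2 * k + 1))%N.
  by rewrite -mulSnr leq_mul2r ltn_neqAle nij lij orbT.
have last : (j * (2 * k + 1) + (2 * k + 1) <= c * (2 * k + 1))%N.
  by rewrite -mulSnr leq_mul2r ltn_ord orbT.
by rewrite /cycle_power xi yj /spaced_vertex; lia.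
Qed.

Lemma spaced_set_maximal c (w : 'I_n) : (n <= c * (2 * k + 1))%N ->
  w \notin spaced_set c -> ~~ indep C (w |: spaced_set c).
Proof.
move=> nc wF; have n0 : (0 < n)%N by apply: leq_ltn_trans (ltn_ord w).
have lt_n j : (spaced_vertex j < n)%N by rewrite /spaced_vertex; lia.
suff [j [jc wj]] : exists j, (j < c)%N /\
    ((w - spaced_vertex j <= k) && (spaced_vertex j - w <= k)
      || (n - k <= w - spaced_vertex j))%N.
  pose u := Ordinal (lt_n j).
  have uF : u \in spaced_set c by rewrite inE; apply/existsP; exists (Ordinal jc).
  apply/negP => /indepP/(_ w u); rewrite setU11 in_setU1 uF orbT => /(_ isT isT).
  have : w != u by apply: contra wF => /eqP->.
  by rewrite -val_eqE /cycle_power /=; lia.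
have := ltn_ord w => ltw.
(* The last k vertices are dominated by 0 around the cycle. Any other [w] is within k of its nearest
   multiple of 2k + 1, and the cap, being at least [w], keeps it so. *)
have [wk|kw] := ltnP w (n - k); last by exists 0%N; rewrite /spaced_vertex; lia.
exists ((w + k) %/ (2 * k + 1))%N.
have := divn_eq (w + k) (2 * k + 1).
have := @ltn_pmod (w + k) (2 * k + 1); rewrite addn1 => /(_ isT).
set q := (_ %/ _)%N; set r := (_ %% _)%N => rk E.
split; last by rewrite /spaced_vertex addn1; lia.
by rewrite -(@ltn_pmul2r (2 * k).+1) //; move: nc; rewrite addn1; lia.
Qed.

End CyclePowers.

(** * Depth bounds for cycle powers and the residue cases *)

Section CyclePowerDepth.
Variables (K : fieldType) (k n : nat).

(** The condition says that c = ceil(n / (2k + 1)); the complete graph is the case c = 1. *)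
Lemma sdepth_cycle_power_le c :
  (n <= c * (2 * k + 1) < n + (2 * k + 1))%N ->
  (sdepth (edge_quot K (cycle_power n k)) <= c)%N.
Proof.
case/andP=> nc cn; apply: leq_trans (card_spaced_set k n c).
apply: sdepth_le_facet (@cycle_power_irr k n) _ _ _.
  exact: indep_spaced_set.
by move=> w; apply: spaced_set_maximal.
Qed.

Lemma sdepth_cycle_power_ge d : (2 * k + 2 <= n)%N ->
  (d * (2 * k + 1) < n - k + (2 * k + 1))%N ->
  (d <= sdepth (edge_quot K (cycle_power n k)))%N.
Proof.
move=> n_ge dn; apply: interval_partition_sdepth (@cycle_power_irr k n) _ _.
exact: interval_partition_cycle.
Qed.

Lemma sdepth_cycle_power_ge1 : (0 < n)%N ->
  (1 <= sdepth (edge_quot K (cycle_power n k)))%N.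
Proof.
move=> n0; apply: interval_partition_sdepth (@cycle_power_irr k n) _ _.
apply: interval_partition1; first exact: cycle_power_irr.
by apply/set0Pn; exists (Ordinal n0); rewrite inE.
Qed.

End CyclePowerDepth.

Lemma ceil_ratio (n c m : nat) : (n <= c * m < n + m)%N ->
  Num.ceil (n%:Q / m%:Q) = c%:Z.
Proof.
case/andP=> nc cn; apply: ceil_def.
have m0 : (0 : rat) < m%:Q by rewrite ltr0n; lia.
rewrite ltr_pdivlMr // ler_pdivrMr // -!intrM ltr_int ler_int.
by apply/andP; split; lia.
Qed.

Theorem corollary4p7 (K : fieldType) (k n : nat)
    (k_ge1 : (1 <= k)%N) (n_ge3 : (3 <= n)%N) :
  ((n <= 2 * k + 1)%N -> sdepth (edge_quot K (cycle_power n k)) = 1%N) /\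
  ((2 * k + 2 <= n)%N ->
    ((n = 0 %[mod 2 * k + 1] \/
      exists2 r : nat, (k + 1 <= r <= 2 * k)%N & n = r %[mod 2 * k + 1]) ->
     (sdepth (edge_quot K (cycle_power n k)))%:Z
       = Num.ceil (n%:Q / (2 * k + 1)%N%:Q)) /\
    ((exists2 r : nat, (1 <= r <= k)%N & n = r %[mod 2 * k + 1]) ->
     Num.ceil (n%:Q / (2 * k + 1)%N%:Q) - 1
       <= (sdepth (edge_quot K (cycle_power n k)))%:Z
       <= Num.ceil (n%:Q / (2 * k + 1)%N%:Q))).
Proof.
split=> [n_le|n_ge].
  apply/eqP; rewrite eqn_leq sdepth_cycle_power_ge1 ?andbT; last by lia.
  by apply: sdepth_cycle_power_le; lia.
have := divn_eq n (2 * k + 1); set q := (_ %/ _)%N => nE.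
have q0 : (0 < q)%N by rewrite divn_gt0; lia.
split=> [[n0|[r /andP[kr r2k] nr]]|[r /andP[r0 rk] nr]].
- have {}nE : n = (q * (2 * k + 1))%N by rewrite {1}nE n0 mod0n addn0.
  rewrite (@ceil_ratio _ q); last by lia.
  congr Posz; apply/eqP; rewrite eqn_leq sdepth_cycle_power_le; last by lia.
  by apply: sdepth_cycle_power_ge; lia.
- have {}nE : n = (q * (2 * k + 1) + r)%N by rewrite {1}nE nr modn_small //; lia.
  rewrite (@ceil_ratio _ q.+1); last by lia.
  congr Posz; apply/eqP; rewrite eqn_leq sdepth_cycle_power_le; last by lia.
  (* Here r > k, so ceil((n - k) / (2k + 1)) is still q + 1. *)
  by apply: sdepth_cycle_power_ge; lia.
have {}nE : n = (q * (2 * k + 1) + r)%N by rewrite {1}nE nr modn_small //; lia.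
rewrite (@ceil_ratio _ q.+1); last by lia.
rewrite lez_nat sdepth_cycle_power_le ?andbT; last by lia.
(* Here r <= k, so ceil((n - k) / (2k + 1)) drops to q, one below the upper bound. *)
have : (q <= sdepth (edge_quot K (cycle_power n k)))%N.
  by apply: sdepth_cycle_power_ge; lia.
by lia.
Qed.
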